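(* For all $n\in\mathbf{N}$ and $v\in V$, $$\boldsymbol{E}[Y_n(v)]=\begin{cases}\frac1m\lceil \frac n2\rceil & \text{if } v\in V_{\mathfrak{o}},\\ \frac1m\lfloor \frac n2\rfloor & \text{if } v\in V_{\mathfrak{e}},\end{cases}$$ where $\lceil\cdot\rceil$ and $\lfloor\cdot\rfloor$ denote the ceiling and floor functions. In particular, $$\boldsymbol{E}[S_n]=\begin{cases}\bar v & \text{if $n$ is odd},\\ 0 & \text{if $n$ is even}.\end{cases}$$ Hence, for all $v\in V$, $$\lim_{n\to\infty}\frac{\boldsymbol{E}[Y_n(v)]}{n}=\frac1{2m},\qquad \lim_{n\to\infty}\frac{\boldsymbol{E}[S_n]}{n}=0\in\mathbf{R}^d.$$
   Context: Setting. Let $d\ge 1$ and let $\mathcal{S}_{\mathfrak{e}},\mathcal{S}_{\mathfrak{o}},V_{\mathfrak{e}},V_{\mathfrak{o}}\subset\mathbf{R}^d$, with $V_{\mathfrak{o}},V_{\mathfrak{e}}$ finite, satisfy: (1) $x+v\in\mathcal{S}_{\mathfrak{o}}$ for $x\in\mathcal{S}_{\mathfrak{e}}$, $v\in V_{\mathfrak{o}}$; (2) $x+v\in\mathcal{S}_{\mathfrak{e}}$ for $x\in\mathcal{S}_{\mathfrak{o}}$, $v\in V_{\mathfrak{e}}$; (3) $V_{\mathfrak{o}}=-V_{\mathfrak{e}}$; (4) $0\in\mathcal{S}_{\mathfrak{e}}$; (5) $V_{\mathfrak{o}}\cap V_{\mathfrak{e}}=\emptyset$. Put $V=V_{\mathfrak{o}}\cup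 V_{\mathfrak{e}}$, let $m$ be the common cardinality of $V_{\mathfrak{o}}$ and $V_{\mathfrak{e}}$, assume $m\ge2$, and set $\bar v=\frac1m\sum_{v\in V_{\mathfrak{o}}}v$. Fix $p,q\in[0,1]$. For each $k\ge2$ and $v\in V$ let $G_k(v)$ be a random variable with values in $V_{\mathfrak{o}}$ if $k$ is odd and in $V_{\mathfrak{e}}$ if $k$ is even, with the following law. Let $W$ denote $V_{\mathfrak{o}}$ if $k$ is odd and $V_{\mathfrak{e}}$ if $k$ is even, and let $w\in W$. If $v\in W$, then $\boldsymbol{P}(G_k(v)=w)=p$ for $w=v$ and $\frac{1-p}{m-1}$ for $w\ne v$. If $v\in V\setminus W$ (so $-v\in W$), then $\boldsymbol{P}(G_k(v)=w)=q$ for $w=-v$ and $\frac{1-q}{m-1}$ for $w\neq -v$. Let $X_1$ be uniform on $V_{\mathfrak{o}}$ and, for $n\ge1$, let $\mathcal{U}_n$ be uniform on $\{1,\dots,n\}$. The $\sigma$-fields $\sigma(X_1),\ \sigma(\mathcal{U}_1,\{G_2(v)\}_{v\in V}),\ \sigma(\mathcal{U}_2,\{G_3(v)\}_{v\in V}),\dots$ are independent, and for each $n\ge1$, $\mathcal{U}_n$ is independent of $\{G_{n+1}(v)\}_{v\in V}$. Define, for $n\geq 1$, $X_{n+1}=G_{n+1}(X_{\mathcal{U}_n})$; and $S_0=0$, $S_{n+1}=S_n+X_{n+1}$ for $n\ge0$ (the elephant random walk). For $v\in V$, $Y_n(v)$ is the number of $k\in\{1,\dots,n\}$ with $X_k=v$.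 *)

(* Defs.v *)
From HB Require Import structures.
From mathcomp Require Export all_boot all_order all_algebra finmap.
From mathcomp Require Export all_classical all_reals all_analysis.
Export Order.TTheory GRing.Theory Num.Theory.
Export numFieldNormedType.Exports.

Set Implicit Arguments.
Unset Strict Implicit.
Unset Printing Implicit Defensive.

Local Open Scope classical_set_scope.
Local Open Scope ring_scope.

(* R^d (row vectors) equipped with its Borel sigma-algebra. *)
Notation borel_rV R d := (g_sigma_algebraType (@open 'rV[R]_d)).

(* The data (S_e, S_o, V_e, V_o) in R^d, with m = #V_o = #V_e. *)
Record step_system (R : realType) (d : nat) (Se So : set 'rV[R]_d)
    (Ve Vo : {fset 'rV[R]_d}) (m : nat) : Prop := StepSystem {
  step_odd : forall x v, Se x -> v \in Vo -> So (x + v);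
  step_even : forall x v, So x -> v \in Ve -> Se (x + v);
  step_opp : Vo = [fset - v | v in Ve]%fset;
  step_origin : Se 0;
  step_disjoint : (Vo `&` Ve)%fset = fset0;
  step_card_odd : #|` Vo| = m;
  step_card_even : #|` Ve| = m;
  step_card_ge2 : (2 <= m)%N }.

Section Independence.
Context {disp : measure_display} {T : measurableType disp} {R : realType}.
Local Open Scope ereal_scope.

(* Mutual independence: product rule over every finite subfamily. *)
Definition independent_sigma_fields (P : probability T R)
    (F : nat -> set (set T)) : Prop :=
  forall (J : {fset nat}) (A : nat -> set T),
    (forall j, j \in J -> F j (A j)) ->
    P (\bigcap_(j in [set` J]) A j) = \prod_(j <- J) P (A j).

Definition independent2_sigma_fields (P : probability T R)
    (F G : set (set T)) : Prop :=
  forall A B, F A -> G B -> P (A `&` B) = P A * P B.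

End Independence.

Section Walk.
Context {disp : measure_display} {T : measurableType disp} {R : realType}
        {d : nat}.

(* V_o at odd times, V_e at even times. *)
Definition step_set (Ve Vo : {fset 'rV[R]_d}) (k : nat) : {fset 'rV[R]_d} :=
  if odd k then Vo else Ve.

(* The law P(G_k(v) = w), for v in V and w in W. *)
Definition memory_law (p q : R) (m : nat) (W : {fset 'rV[R]_d})
    (v w : 'rV[R]_d) : R :=
  if v \in W then (if w == v then p else (1 - p) / (m%:R - 1))
  else (if w == - v then q else (1 - q) / (m%:R - 1)).

(* sigma({G(v)}_{v in V}) *)
Definition sigma_memory (V : {fset 'rV[R]_d})
    (G : 'rV[R]_d -> T -> 'rV[R]_d) : set (set T) :=
  <<s \bigcup_(v in [set` V])
        g_sigma_algebra_preimage (G v : T -> borel_rV R d) >>.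

(* sigma(U, {G(v)}_{v in V}) *)
Definition sigma_step (V : {fset 'rV[R]_d}) (U : T -> nat)
    (G : 'rV[R]_d -> T -> 'rV[R]_d) : set (set T) :=
  <<s g_sigma_algebra_preimage U `|` sigma_memory V G >>.

(* Only X n, U n for n >= 1 and G n v for n >= 2, v in V, are constrained. *)
Record elephant_walk (P : probability T R) (Ve Vo : {fset 'rV[R]_d}) (m : nat)
    (p q : R) (U : nat -> T -> nat) (G : nat -> 'rV[R]_d -> T -> 'rV[R]_d)
    (X : nat -> T -> 'rV[R]_d) : Prop := ElephantWalk {
  G_measurable : forall k v, (2 <= k)%N -> v \in (Vo `|` Ve)%fset ->
    measurable_fun [set: T] (G k v : T -> borel_rV R d);
  G_range : forall k v t, (2 <= k)%N -> v \in (Vo `|` Ve)%fset ->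
    G k v t \in step_set Ve Vo k;
  G_law : forall k v w, (2 <= k)%N -> v \in (Vo `|` Ve)%fset ->
    w \in step_set Ve Vo k ->
    P (G k v @^-1` [set w]) = (memory_law p q m (step_set Ve Vo k) v w)%:E;
  X1_measurable : measurable_fun [set: T] (X 1%N : T -> borel_rV R d);
  X1_range : forall t, X 1%N t \in Vo;
  X1_law : forall w, w \in Vo -> P (X 1%N @^-1` [set w]) = (m%:R^-1)%:E;
  U_measurable : forall n, (1 <= n)%N -> measurable_fun [set: T] (U n);
  U_range : forall n t, (1 <= n)%N -> (1 <= U n t <= n)%N;
  U_law : forall n j, (1 <= j <= n)%N -> P (U n @^-1` [set j]) = (n%:R^-1)%:E;
  steps_independent : independent_sigma_fields P (fun n =>
    if n is 0 then g_sigma_algebra_preimage (X 1%N : T -> borel_rV R d)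
    else sigma_step (Vo `|` Ve)%fset (U n) (G n.+1));
  U_G_independent : forall n, (1 <= n)%N ->
    independent2_sigma_fields P (g_sigma_algebra_preimage (U n))
      (sigma_memory (Vo `|` Ve)%fset (G n.+1));
  X_rec : forall n t, (1 <= n)%N -> X n.+1 t = G n.+1 (X (U n t) t) t }.

Fixpoint position (X : nat -> T -> 'rV[R]_d) (n : nat) (t : T) : 'rV[R]_d :=
  if n is n'.+1 then position X n' t + X n t else 0.

Definition visits (X : nat -> T -> 'rV[R]_d) (v : 'rV[R]_d) (n : nat) (t : T)
    : nat :=
  count (fun k => X k t == v) (iota 1 n).

Definition mean_step (Vo : {fset 'rV[R]_d}) (m : nat) : 'rV[R]_d :=
  m%:R^-1 *: \sum_(v <- Vo) v.

(* Expectation of a random vector, coordinate by coordinate.  The coordinates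
   are kept in \bar R, so that an equation with the image of a real vector
   also says that the expectation is finite. *)
Definition expectation_rV (P : probability T R) (Z : T -> 'rV[R]_d)
    : 'rV[\bar R]_d :=
  \row_i 'E_P[fun t => Z t ord0 i]%E.

End Walk.

(* Main.v *)
Require Import Defs.
From mathcomp Require Import ring lra.
Set Implicit Arguments.
Unset Strict Implicit.
Unset Printing Implicit Defensive.

Local Open Scope classical_set_scope.
Local Open Scope ring_scope.

(** The key fact is that every step of the walk is uniform on the set it lives
    in: [X k] is uniform on [Vo] for odd [k] and on [Ve] for even [k], whatever
    [p] and [q] are.  Suppose this holds up to time [n].  The next step is drawn
    by picking a past time [j] uniformly and applying the random map [G n.+1]
    to [X j].  Given [j], the recalled value [v] is uniform on the step set of
    parity [j], and the transition matrix [memory_law] from that set to the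
    step set of time [n.+1] is doubly stochastic: each of its columns consists
    of one entry [p] (or [q]) and of [m - 1] entries [(1 - p) / (m - 1)] (or the
    same with [q]), so it sums to [1] ([sum_memory_law]).  A doubly stochastic
    matrix carries the uniform law to the uniform law.

    The probabilistic point is that [X j], for [j <= n], is independent of the
    randomness [(U n, G n.+1)].  Rather than grouping independent sigma-fields
    by a monotone class argument, the induction carries this along:
    [X_law_indep_future] says that [X k] is uniform and, jointly, independent
    of any finite family of events from the sigma-fields of index at least [k].
    Splitting [X n.+1 = w] according to the recalled time and value writes it
    as a finite disjoint union of events [X j = v] intersected with an event of
    the field [n], to which the induction hypothesis applies with one more
    future event.

    The expectation of [visits X v n] is then [1 / m] times the number of times
    [k] in [1 .. n] of the parity of [v] ([expectation_visits]), which is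
    [uphalf n] or [n./2].  Since the position is the sum over [v] of
    [visits X v n] times [v] ([position_visits]) and [Ve = - Vo], its mean is
    [(uphalf n - n./2) / m] times the sum of [Vo], that is, [odd n] times the
    mean step.  The limits follow from [odd n / n --> 0]. *)

(** * Finite partitions and finite families of events *)

Lemma measurable_singleton_rV (R : realType) (d : nat) (w : 'rV[R]_d) :
  measurable ([set w] : set (borel_rV R d)).
Proof.
rewrite -[X in measurable X]setCK; apply: measurableC.
apply: sub_sigma_algebra; rewrite openC.
exact/accessible_closed_set1/hausdorff_accessible/norm_hausdorff.
Qed.

Section Partition.
Context {disp : measure_display} {T : measurableType disp} {R : realType}
  {K : choiceType}.
Variables (mu : {measure set T -> \bar R}) (f : T -> K) (s : seq K)
  (B : set T).
Hypothesis fs : forall t, B t -> f t \in s.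
Hypothesis mB : forall k, k \in s -> measurable (B `&` f @^-1` [set k]).

Let partitionE : B = \bigcup_(k in [set` s]) (B `&` f @^-1` [set k]).
Proof.
apply/seteqP; split=> [t Bt|t [k _ []]] //.
by exists (f t) => //=; exact: fs.
Qed.

Lemma measurable_partition : measurable B.
Proof. by rewrite partitionE; apply: fin_bigcup_measurable. Qed.

Lemma measure_partition : uniq s ->
  mu B = (\sum_(k <- s) mu (B `&` f @^-1` [set k]))%E.
Proof.
move=> us.
have pm : forall k, [set` s] k -> measurable (B `&` f @^-1` [set k]).
  exact: mB.
have tr : trivIset [set` s] (fun k => B `&` f @^-1` [set k]).
  by move=> i j _ _ [t [[_ <-] [_ <-]]].
rewrite fsbig_seq // -measure_fin_bigcup //.
by rewrite -partitionE.
Qed.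

End Partition.

Definition adjoin (S : Type) (i : nat) (B : S) (A : nat -> S) : nat -> S :=
  fun j => if j == i then B else A j.

Section Adjoin.
Context {disp : measure_display} {T : measurableType disp} {R : realType}.
Variables (J : {fset nat}) (i : nat) (A : nat -> set T) (B : set T).
Hypothesis iJ : i \notin J.

Lemma adjoin_eq j : j \in J -> adjoin i B A j = A j.
Proof. by move=> jJ; rewrite /adjoin; case: eqP iJ => // <-; rewrite jJ. Qed.

Lemma bigcap_adjoin :
  \bigcap_(j in [set` (i |` J)%fset]) adjoin i B A j =
  B `&` \bigcap_(j in [set` J]) A j.
Proof.
rewrite bigcap_fsetU1 /= {1}/adjoin eqxx; congr (_ `&` _).
by apply: eq_bigcapr => j /= /adjoin_eq.
Qed.

Lemma prod_adjoin (P : set T -> \bar R) :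
  (\prod_(j <- (i |` J)%fset) P (adjoin i B A j) =
   P B * \prod_(j <- J) P (A j))%E.
Proof.
rewrite big_fsetU1 //= {1}/adjoin eqxx; congr (_ * _)%E.
by apply: eq_big_seq => j /adjoin_eq /= ->.
Qed.

End Adjoin.

(** * Columns of the transition matrix *)

(** The non-distinguished [m - 1] elements share the mass [1 - r] equally. *)
Lemma sum_spread (R : realType) (K : choiceType) (A : {fset K}) (m : nat)
    (a : K) (r : R) :
  #|` A| = m -> (2 <= m)%N -> a \in A ->
  \sum_(v <- A) (if v == a then r else (1 - r) / (m%:R - 1)) = 1.
Proof.
move=> cA m2 aA.
rewrite (big_fsetD1 a) //= eqxx.
rewrite (@eq_big_seq _ _ _ _ _ _ (fun=> (1 - r) / (m%:R - 1))); last first.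
  by move=> v; rewrite !inE => /andP[/negPf ->].
have := cardfsD1 a A; rewrite cA aA /= add1n => cA'.
rewrite big_const_seq count_predT iter_addr_0 -[_ *+ size _]mulr_natr.
have -> : (size (A `\ a)%fset)%:R = m%:R - 1 :> R.
  by rewrite [in RHS]cA' -natr1 addrK.
by rewrite divfK ?subrKC // subr_eq0 pnatr_eq1;
  case: m m2 {cA cA'} => [|[]].
Qed.

Section StepSystem.
Context {R : realType} {d : nat} {Se So : set 'rV[R]_d}
  {Ve Vo : {fset 'rV[R]_d}} {m : nat}.
Hypothesis hV : step_system Se So Ve Vo m.

Local Notation W := (step_set Ve Vo).

Lemma card_step_set k : #|` W k| = m.
Proof.
rewrite /step_set; case: (odd k); first exact: step_card_odd hV.
exact: step_card_even hV.
Qed.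

Lemma mem_VoN v : (v \in Vo) = (- v \in Ve).
Proof.
rewrite (step_opp hV); apply/imfsetP/idP => [[u /= uVe ->]|vVe].
  by rewrite opprK.
by exists (- v); rewrite ?opprK.
Qed.

Lemma Vo_notin_Ve v : v \in Vo -> v \notin Ve.
Proof.
move=> vVo; apply/negP => vVe.
by have /fsetP/(_ v) := step_disjoint hV; rewrite !inE vVo vVe.
Qed.

Lemma mem_step_setN j k v : odd j != odd k -> (- v \in W j) = (v \in W k).
Proof.
by rewrite /step_set; case: (odd j); case: (odd k) => // _;
  rewrite mem_VoN ?opprK.
Qed.

Lemma step_set_disjoint j k v :
  v \in W j -> (v \in W k) = (odd k == odd j).
Proof.
rewrite /step_set; case: (odd j); case: (odd k) => //= vW.
  exact/negbTE/Vo_notin_Ve.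
by apply: contraTF vW => /Vo_notin_Ve.
Qed.

(** The rows of the transition matrix sum to one because they are laws; the
    columns do too.  If the step sets at times [j] and [k] coincide, the column
    of [w] has its special entry [p] at [v = w]; otherwise the step sets are
    opposite to each other and the special entry [q] is at [v = - w]. *)
Lemma sum_memory_law (p q : R) j k w : w \in W k ->
  \sum_(v <- W j) memory_law p q m (W k) v w = 1.
Proof.
move=> wW; have m2 := step_card_ge2 hV.
have [jk|jk] := eqVneq (odd j) (odd k).
  rewrite -(@sum_spread R _ (W j) m w p (card_step_set j) m2); last first.
    by rewrite (step_set_disjoint _ wW) jk.
  apply: eq_big_seq => v vW.
  by rewrite /memory_law (step_set_disjoint _ vW) jk eqxx eq_sym.
rewrite -(@sum_spread R _ (W j) m (- w) q (card_step_set j) m2); last first.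
  by rewrite (mem_step_setN _ jk).
apply: eq_big_seq => v vW.
by rewrite /memory_law (step_set_disjoint _ vW) [odd k == _]eq_sym (negbTE jk)
  -eqr_oppLR eq_sym.
Qed.

Lemma sum_Ve : \sum_(v <- Ve) v = - \sum_(v <- Vo) v.
Proof.
rewrite (step_opp hV) big_imfset /=; last by move=> u v _ _; exact: oppr_inj.
by rewrite sumrN opprK.
Qed.

End StepSystem.

(** * Counting parities and linearity of expectation *)

Lemma count_odd_iota n : count odd (iota 1 n) = uphalf n.
Proof.
elim: n => // n IH; rewrite -(addn1 n) iotaD count_cat IH /= addn0 addn1.
by rewrite uphalf_half; case: (odd n); rewrite /= ?addn0 ?addn1.
Qed.

Lemma count_even_iota n : count (predC odd) (iota 1 n) = n./2.
Proof.
have := count_predC odd (iota 1 n).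
rewrite size_iota count_odd_iota -[RHS]odd_double_half uphalf_half -addnn -addnA.
by move=> /addnI/addnI.
Qed.

Section LinearCombination.
Context {disp : measure_display} {T : measurableType disp} {R : realType}.
Variable P : probability T R.

Lemma indic_Lfun1 (A : set T) : measurable A -> (\1_A : T -> R) \in Lfun P 1.
Proof. by move=> mA; apply/Lfun1_integrable; exact: integrable_indic. Qed.

Context {K : eqType}.
Variables (c : K -> R) (f : K -> T -> R).

Lemma lincomb_Lfun1 (s : seq K) :
  (forall k, k \in s -> f k \in Lfun P 1) ->
  (fun t => \sum_(k <- s) f k t * c k) \in Lfun P 1.
Proof.
elim: s => [|k s IH] fs.
  by under eq_fun do rewrite big_nil; exact: Lfun_cst.
under eq_fun do rewrite big_cons.
apply: (@rpredD _ (Lfun P 1) (c k \o* f k)).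
  by rewrite Lfun_scale ?fs ?mem_head.
by apply: IH => j js; rewrite fs // inE js orbT.
Qed.

Lemma expectation_lincomb (s : seq K) :
  (forall k, k \in s -> f k \in Lfun P 1) ->
  'E_P[fun t => (\sum_(k <- s) f k t * c k)%R]%E =
  (\sum_(k <- s) (c k)%:E * 'E_P[f k])%E.
Proof.
elim: s => [|k s IH] fs.
  by rewrite big_nil; under eq_fun do rewrite big_nil; exact: expectation_cst.
have fk : f k \in Lfun P 1 by rewrite fs ?mem_head.
have fs' j : j \in s -> f j \in Lfun P 1.
  by move=> js; rewrite fs // inE js orbT.
under eq_fun do rewrite big_cons.
rewrite big_cons -IH // -expectationZl // -expectationD //.
  by rewrite Lfun_scale.
exact: lincomb_Lfun1.
Qed.

End LinearCombination.

(** * The law of the steps *)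

Section Walk.
Context {disp : measure_display} {T : measurableType disp} {R : realType}
  {d : nat} {Se So : set 'rV[R]_d} {Ve Vo : {fset 'rV[R]_d}} {m : nat}
  {p q : R} {P : probability T R} {U : nat -> T -> nat}
  {G : nat -> 'rV[R]_d -> T -> 'rV[R]_d} {X : nat -> T -> 'rV[R]_d}.
Hypothesis hV : step_system Se So Ve Vo m.
Hypothesis hX : elephant_walk P Ve Vo m p q U G X.

Local Notation W := (step_set Ve Vo).
Local Notation V := (Vo `|` Ve)%fset.

(** The fields whose independence is assumed: the fields of index at least
    [k] carry the randomness that is used after time [k]. *)
Definition step_field (n : nat) : set (set T) :=
  if n is 0 then g_sigma_algebra_preimage (X 1%N : T -> borel_rV R d)
  else sigma_step V (U n) (G n.+1).

Lemma step_setV k v : v \in W k -> v \in V.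
Proof. by rewrite /step_set inE; case: odd => ->; rewrite ?orbT. Qed.

Lemma X_step_set k t : (1 <= k)%N -> X k t \in W k.
Proof.
elim/ltn_ind: k => -[|[|k]] // IH _; first exact: X1_range hX t.
rewrite (X_rec hX) //; apply: (G_range hX) => //.
have /andP[U1 Uk] := U_range hX t (isT : (1 <= k.+1)%N).
by apply: step_setV; apply: IH.
Qed.

Lemma sigma_memory_measurable n B : (1 <= n)%N ->
  sigma_memory V (G n.+1) B -> measurable B.
Proof.
move=> n1; apply: smallest_sub; first exact: sigma_algebra_measurable.
move=> C [v /= vV [D mD <-]].
exact: (G_measurable hX).
Qed.

Lemma step_field_measurable n B : step_field n B -> measurable B.
Proof.
case: n => [[D mD <-]|n]; first exact: (X1_measurable hX).
apply: smallest_sub; first exact: sigma_algebra_measurable.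
move=> C [[D mD <-]|]; first exact: (U_measurable hX).
exact: sigma_memory_measurable.
Qed.

Lemma sigma_memory_preimage n v w : v \in V ->
  sigma_memory V (G n) (G n v @^-1` [set w]).
Proof.
move=> vV; apply: sub_sigma_algebra; exists v => //.
exists [set w]; first exact: measurable_singleton_rV.
by rewrite setTI.
Qed.

Lemma U_preimage n j : g_sigma_algebra_preimage (U n) (U n @^-1` [set j]).
Proof. by exists [set j]; rewrite ?setTI. Qed.

Lemma step_field_move n j v w : (1 <= n)%N -> v \in V ->
  step_field n (U n @^-1` [set j] `&` G n.+1 v @^-1` [set w]).
Proof.
case: n => // n _ vV; rewrite /step_field /sigma_step.
set S := (_ `|` _); apply: (@measurableI _ (g_sigma_algebraType S)).
  by apply: sub_sigma_algebra; left; exact: U_preimage.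
by apply: sub_sigma_algebra; right; exact: sigma_memory_preimage.
Qed.

Lemma P_move n j v w : (1 <= j <= n)%N -> v \in V -> w \in W n.+1 ->
  P (U n @^-1` [set j] `&` G n.+1 v @^-1` [set w]) =
  (n%:R^-1 * memory_law p q m (W n.+1) v w)%:E.
Proof.
move=> jn vV wW; have n1 : (1 <= n)%N by case/andP: jn; exact: leq_trans.
rewrite (U_G_independent hX n1 (U_preimage n j)); last first.
  exact: sigma_memory_preimage.
by rewrite (U_law hX) // (G_law hX).
Qed.

(** The step at time [n.+1] is split according to the recalled time and the
    value of the step taken at that time. *)
Let recalls n : seq (nat * 'rV[R]_d) :=
  [seq (j, v) | j <- iota 1 n, v <- W j].
Let recall n t := (U n t, X (U n t) t).

Let uniq_recalls n : uniq (recalls n).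
Proof.
apply: allpairs_uniq_dep; first exact: iota_uniq.
  by move=> j _; exact: fset_uniq.
by move=> [j v] [j' v'] _ _ /= [-> ->].
Qed.

Let mem_recall n t : (1 <= n)%N -> recall n t \in recalls n.
Proof.
move=> n1; have /andP[U1 Un] := U_range hX t n1.
apply/allpairsPdep; exists (U n t), (X (U n t) t); split=> //.
  by rewrite mem_iota U1 add1n ltnS.
exact: X_step_set.
Qed.

Let recallE n j v w C : (1 <= n)%N ->
  (X n.+1 @^-1` [set w] `&` C) `&` recall n @^-1` [set (j, v)] =
  X j @^-1` [set v] `&`
   ((U n @^-1` [set j] `&` G n.+1 v @^-1` [set w]) `&` C).
Proof.
move=> n1; apply/seteqP; rewrite /recall; split => t /=.
  by rewrite (X_rec hX) // => -[[Xw Ct] [<- <-]].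
by rewrite (X_rec hX) // => -[Xv [[-> Gw] Ct]]; rewrite Xv.
Qed.

Let recalls_range n j v : (j, v) \in recalls n ->
  (1 <= j <= n)%N /\ v \in W j.
Proof.
case/allpairsPdep => j' [v' [+ + [-> ->]]].
by rewrite mem_iota add1n ltnS.
Qed.

Lemma X_preimage_measurable k w : (1 <= k)%N ->
  measurable (X k @^-1` [set w]).
Proof.
elim/ltn_ind: k w => -[|[|n]] // IH w _.
  rewrite -[X in measurable X]setTI; apply: (X1_measurable hX) => //.
  exact: measurable_singleton_rV.
rewrite -[X in measurable X]setIT.
apply: (@measurable_partition _ _ _ (recall n.+1) (recalls n.+1)).
  by move=> t _; exact: mem_recall.
move=> [j v] /recalls_range[/andP[j1 jn] vW].
rewrite recallE // setIT; apply: measurableI; first exact: IH.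
by apply: step_field_measurable; apply: step_field_move => //;
  exact: step_setV vW.
Qed.

(** Uniformity is proved together with independence from the future because
    the inductive step needs both: with [X n.+1] expressed through an earlier
    [X j], the events [U n = j] and [G n.+1 v = w] become one more event of the
    future of [j], namely one of the field [n]. *)
Lemma X_law_indep_future k w (J : {fset nat}) (A : nat -> set T) :
  (1 <= k)%N -> w \in W k ->
  (forall j, j \in J -> (k <= j)%N /\ step_field j (A j)) ->
  P (X k @^-1` [set w] `&` \bigcap_(j in [set` J]) A j) =
  ((m%:R^-1)%:E * \prod_(j <- J) P (A j))%E.
Proof.
elim/ltn_ind: k w J A => -[|[|n]] // IH w J A _ wW JA.
  (* Time 1: the field of index 0 is that of [X 1], so this is the assumed
     product rule for [0 |` J]. *)
  have J0 : 0%N \notin J by apply/negP => /JA[].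
  rewrite -(@X1_law _ _ _ _ _ _ _ _ _ _ _ _ _ hX w) //.
  rewrite -(bigcap_adjoin A _ J0) -(prod_adjoin A _ J0).
  apply: (steps_independent hX) => j; rewrite !inE => /orP[/eqP ->|jJ].
    rewrite /adjoin eqxx; exists [set w]; first exact: measurable_singleton_rV.
    by rewrite setTI.
  rewrite (adjoin_eq A _ J0 jJ); exact: (JA _ jJ).2.
set C := \bigcap_(j in _) _.
have nJ : n.+1 \notin J by apply/negP => /JA[]; rewrite ltnn.
have mC : measurable C.
  by apply: fin_bigcap_measurable => // j /JA[_]; exact: step_field_measurable.
have PC : P C = (\prod_(j <- J) P (A j))%E.
  by apply: (steps_independent hX) => j /JA[].
pose B := X n.+2 @^-1` [set w] `&` C.
have -> : P B =
    (\sum_(r <- recalls n.+1) P (B `&` recall n.+1 @^-1` [set r]))%E.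
  apply: measure_partition.
  - by move=> t _; exact: mem_recall.
  - move=> [j v] /recalls_range[/andP[j1 jn] vW]; rewrite recallE //.
    apply: measurableI; first exact: X_preimage_measurable.
    apply: measurableI => //; apply: step_field_measurable.
    by apply: step_field_move => //; exact: step_setV vW.
  - exact: uniq_recalls.
(* The product of the [P (A j)] is [P C], hence a real number, and the double
   sum over [j] and [v] can be computed in the reals. *)
rewrite -PC -(fineK (fin_num_measure P C mC)) big_allpairs_dep.
rewrite (eq_big_seq (fun j => \sum_(v <- W j)
   (m%:R^-1 * (n.+1%:R^-1 * memory_law p q m (W n.+2) v w) *
      fine (P C))%:E)%E); last first.
  move=> j; rewrite mem_iota add1n ltnS => /andP[j1 jn].
  apply: eq_big_seq => v vW; have vV := step_setV vW.
  (* The event of the field [n.+1] joins the events [A] of index at least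
     [n.+2], and all of these belong to the future of [j <= n.+1]. *)
  rewrite recallE // -(bigcap_adjoin A _ nJ) IH //; last first.
    move=> i; rewrite !inE => /orP[/eqP ->|iJ].
      split=> //.
      by rewrite /adjoin eqxx; exact: step_field_move.
    have [ni Ai] := JA _ iJ; rewrite (adjoin_eq A _ nJ iJ); split=> //.
    exact: leq_trans jn (ltnW ni).
  rewrite prod_adjoin // -PC P_move ?j1 // -(fineK (fin_num_measure P C mC)).
  by rewrite -!EFinM !mulrA.
under eq_bigr do rewrite sumEFin -mulr_suml -mulr_sumr -mulr_sumr.
rewrite (eq_bigr (fun=> (m%:R^-1 * n.+1%:R^-1 * fine (P C))%:E)); last first.
  by move=> j _; rewrite (sum_memory_law hV) // mulr1.
rewrite sumEFin big_const_seq count_predT size_iota iter_addr_0.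
rewrite -EFinM; congr EFin.
by rewrite -[_ *+ n.+1]mulr_natr mulrAC divfK // pnatr_eq0.
Qed.

Lemma X_law k w : (1 <= k)%N -> w \in W k ->
  P (X k @^-1` [set w]) = (m%:R^-1)%:E.
Proof.
move=> k1 wW; have := @X_law_indep_future k w fset0 (fun=> setT) k1 wW.
by rewrite big_seq_fset0 mule1 set_fset0 bigcap_set0 setIT; apply.
Qed.


(** * Expected number of visits and expected position *)

Lemma X_law_all k v : (1 <= k)%N ->
  P (X k @^-1` [set v]) = (m%:R^-1 * (v \in W k)%:R)%:E.
Proof.
move=> k1; have [vW|vW] := boolP (v \in W k); first by rewrite X_law //= mulr1.
rewrite mulr0 (_ : _ @^-1` _ = set0) ?measure0 //.
by apply/seteqP; split=> t //= Xv; move: vW; rewrite -Xv X_step_set.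
Qed.

Lemma visitsE v n t : (visits X v n t)%:R =
  \sum_(k <- iota 1 n) \1_(X k @^-1` [set v]) t * 1 :> R.
Proof.
rewrite /visits; elim: (iota 1 n) => [|k s IH]; first by rewrite big_nil.
rewrite big_cons /= natrD IH indicE mulr1; congr (_%:R + _).
by congr nat_of_bool; apply/eqP/idP; rewrite inE.
Qed.

Lemma visits_Lfun1 v n : (fun t => (visits X v n t)%:R) \in Lfun P 1.
Proof.
under eq_fun do rewrite visitsE.
apply: lincomb_Lfun1 => k; rewrite mem_iota => /andP[k1 _].
exact/indic_Lfun1/X_preimage_measurable.
Qed.

Lemma expectation_visits v n :
  'E_P[fun t => (visits X v n t)%:R]%E =
  (m%:R^-1 * (count (fun k => v \in W k) (iota 1 n))%:R)%:E.
Proof.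
under eq_fun do rewrite visitsE.
rewrite expectation_lincomb; last first.
  move=> k; rewrite mem_iota => /andP[k1 _].
  exact/indic_Lfun1/X_preimage_measurable.
rewrite (eq_big_seq (fun k => (m%:R^-1 * (v \in W k)%:R)%:E)); last first.
  move=> k; rewrite mem_iota mul1e => /andP[k1 _].
  by rewrite expectation_indic ?X_law_all //; exact: X_preimage_measurable.
rewrite sumEFin -mulr_sumr -natr_sum; congr (_ * _%:R)%:E.
by rewrite -sum1_count [RHS]big_mkcond; apply: eq_bigr => k _; case: ifP.
Qed.

Lemma expectation_visits_Vo v n : v \in Vo ->
  'E_P[fun t => (visits X v n t)%:R]%E = (m%:R^-1 * (uphalf n)%:R)%:E.
Proof.
move=> vVo; rewrite expectation_visits -count_odd_iota.
have vW : v \in W 1 by [].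
by under eq_count do rewrite (step_set_disjoint hV _ vW) eqb_id.
Qed.

Lemma expectation_visits_Ve v n : v \in Ve ->
  'E_P[fun t => (visits X v n t)%:R]%E = (m%:R^-1 * (n./2)%:R)%:E.
Proof.
move=> vVe; rewrite expectation_visits -count_even_iota.
have vW : v \in W 0 by [].
by under eq_count do rewrite (step_set_disjoint hV _ vW) eqbF_neg.
Qed.

Lemma visitsS v n t :
  visits X v n.+1 t = (visits X v n t + (X n.+1 t == v))%N.
Proof.
by rewrite /visits -[in iota _ n.+1](addn1 n) iotaD count_cat /= addn0.
Qed.

(** The steps up to time [n], grouped by their value. *)
Lemma position_visits n t :
  position X n t =
  \sum_(v <- enum_fset Vo ++ enum_fset Ve) (visits X v n t)%:R *: v.
Proof.
elim: n => [|n IH]; first by rewrite big1 // => v _; rewrite scale0r.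
rewrite [LHS]/= IH [RHS](eq_bigr (fun v => (visits X v n t)%:R *: v +
    (X n.+1 t == v)%:R *: v)); last first.
  by move=> v _; rewrite visitsS natrD scalerDl.
rewrite big_split /=; congr (_ + _).
have uV : uniq (enum_fset Vo ++ enum_fset Ve).
  rewrite cat_uniq !fset_uniq andbT; apply/hasPn => v vVe.
  by apply: contraL vVe; exact: (Vo_notin_Ve hV).
have XV : X n.+1 t \in enum_fset Vo ++ enum_fset Ve.
  have : X n.+1 t \in V by apply: step_setV; exact: X_step_set.
  by rewrite inE mem_cat.
rewrite (bigD1_seq _ XV uV) /= eqxx scale1r big1 ?addr0 // => v.
by rewrite eq_sym => /negPf ->; rewrite scale0r.
Qed.

(** The contributions of [Vo] and of [Ve = - Vo] cancel, except for the one
    odd time in excess when [n] is odd: [uphalf n - n./2 = odd n]. *)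
Lemma expectation_position n :
  expectation_rV P (position X n) = map_mx EFin ((odd n)%:R *: mean_step Vo m).
Proof.
apply/rowP => i; rewrite !mxE.
under eq_fun => t.
  rewrite position_visits summxE.
  under eq_bigr do rewrite mxE.
  over.
rewrite expectation_lincomb; last by move=> v _; exact: visits_Lfun1.
rewrite big_cat /=.
rewrite (eq_big_seq
  (fun v : 'rV_d => (m%:R^-1 * (uphalf n)%:R * v 0 i)%:E)); last first.
  by move=> v vVo; rewrite expectation_visits_Vo // -EFinM mulrC.
rewrite [X in (_ + X)%E](eq_big_seq
  (fun v : 'rV_d => (m%:R^-1 * (n./2)%:R * v 0 i)%:E)); last first.
  by move=> v vVo; rewrite expectation_visits_Ve // -EFinM mulrC.
rewrite !sumEFin -!mulr_sumr -EFinD -!summxE (sum_Ve hV) mxE summxE.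
rewrite uphalf_half natrD.
congr EFin; ring.
Qed.

End Walk.

(** * Halves: rounding and limits *)

Section Parity.
Context {R : realType}.

Lemma half_natr n : (n./2)%:R = (n%:R - (odd n)%:R) / 2 :> R.
Proof.
by rewrite -[in n%:R](odd_double_half n) natrD addrC addKr -muln2 natrM mulfK.
Qed.

Lemma uphalf_natr n : (uphalf n)%:R = (n%:R + (odd n)%:R) / 2 :> R.
Proof. by rewrite uphalf_half natrD half_natr; field. Qed.

Lemma floor_half n : Num.floor (n%:R / 2 : R) = n./2.
Proof.
apply: floor_def; rewrite rmorphD /= -!pmulrn.
by rewrite half_natr; case: (odd n); rewrite /= ?mulr1n ?mulr0n; lra.
Qed.

Lemma ceil_half n : Num.ceil (n%:R / 2 : R) = uphalf n.
Proof.
apply: ceil_def; rewrite rmorphB /= -!pmulrn.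
by rewrite uphalf_natr; case: (odd n); rewrite /= ?mulr1n ?mulr0n; lra.
Qed.

Lemma cvg_invn : (n%:R^-1 : R) @[n --> \oo] --> 0.
Proof.
apply/(gtr0_cvgV0 (f := fun n => n%:R)); last exact: cvgr_idn.
by exists 1%N => // n /= n1; rewrite ltr0n.
Qed.

Lemma cvg_odd_div : (n%:R^-1 * (odd n)%:R : R) @[n --> \oo] --> 0.
Proof.
apply: (squeeze_cvgr _ (cvg_cst 0) cvg_invn); apply: nearW => n.
by case: (odd n); rewrite /= ?mulr1 ?mulr0 ?lexx ?invr_ge0 ?ler0n.
Qed.

(** With [e = 1] the numerator is [uphalf n], with [e = - 1] it is [n./2]. *)
Lemma cvg_half_div (e : R) :
  ((n%:R + e * (odd n)%:R) / 2 * n%:R^-1 : R) @[n --> \oo] --> (2^-1 : R).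
Proof.
have lim : (2^-1 + (e / 2) * (n%:R^-1 * (odd n)%:R) : R) @[n --> \oo]
    --> (2^-1 : R).
  rewrite -[X in _ --> X]addr0 -[X in _ + X](mulr0 (e / 2)).
  by apply: cvgD; [exact: cvg_cst|apply: cvgMl_tmp; exact: cvg_odd_div].
apply: cvg_trans lim; apply: near_eq_cvg.
exists 1%N => // n /= n1.
by field; rewrite pnatr_eq0 -lt0n.
Qed.

End Parity.

(** * Means and asymptotic frequencies of the walk *)

Theorem theorem2p10 (R : realType) (d : nat) (hd : (1 <= d)%N)
    (Se So : set 'rV[R]_d) (Ve Vo : {fset 'rV[R]_d}) (m : nat)
    (hV : step_system Se So Ve Vo m)
    (p q : R) (hp : 0 <= p <= 1) (hq : 0 <= q <= 1)
    (disp : measure_display) (T : measurableType disp) (P : probability T R)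
    (U : nat -> T -> nat) (G : nat -> 'rV[R]_d -> T -> 'rV[R]_d)
    (X : nat -> T -> 'rV[R]_d)
    (hX : elephant_walk P Ve Vo m p q U G X) :
  [/\ forall (n : nat) (v : 'rV[R]_d),
        (v \in Vo -> 'E_P[fun t => (visits X v n t)%:R]%E
           = (m%:R^-1 * (Num.ceil (n%:R / 2 : R))%:~R)%:E)
        /\ (v \in Ve -> 'E_P[fun t => (visits X v n t)%:R]%E
           = (m%:R^-1 * (Num.floor (n%:R / 2 : R))%:~R)%:E),
      forall n : nat,
        expectation_rV P (position X n)
          = map_mx EFin (if odd n then mean_step Vo m else 0),
      forall v : 'rV[R]_d, v \in (Vo `|` Ve)%fset ->
        ('E_P[fun t => (visits X v n t)%:R] * (n%:R^-1)%:E)%E @[n --> \oo]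
          --> ((2 * m%:R)^-1)%:E
    & n%:R^-1 *: map_mx fine (expectation_rV P (position X n)) @[n --> \oo]
        --> (0 : 'rV[R]_d)].
Proof.
have EVo := expectation_visits_Vo hV hX.
have EVe := expectation_visits_Ve hV hX.
have ES := expectation_position hV hX.
have cvg_frequency (u : nat -> R) : u n * n%:R^-1 @[n --> \oo] --> (2^-1 : R) ->
    ((m%:R^-1 * u n)%:E * (n%:R^-1)%:E)%E @[n --> \oo] --> ((2 * m%:R)^-1)%:E.
  move=> ulim; under eq_fun do rewrite -EFinM -mulrA.
  apply: cvg_EFin; first exact: nearW.
  by rewrite invfM mulrC; apply: cvgMl_tmp.
split.
- move=> n v; split=> vV; first by rewrite EVo // ceil_half.
  by rewrite EVe // floor_half.
- move=> n; rewrite ES; congr map_mx.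
  by case: (odd n); rewrite ?scale1r ?scale0r.
- move=> v; rewrite inE => /orP[] vV.
    under eq_fun do rewrite EVo //; apply: cvg_frequency.
    under eq_fun do rewrite uphalf_natr -[X in _ + X]mul1r.
    exact: cvg_half_div.
  under eq_fun do rewrite EVe //; apply: cvg_frequency.
  under eq_fun do rewrite half_natr -[X in _ + X]mulN1r.
  exact: cvg_half_div.
- have -> : (fun n => n%:R^-1 *: map_mx fine (expectation_rV P (position X n)))
    = (fun n => (n%:R^-1 * (odd n)%:R) *: mean_step Vo m).
    by apply/funext => n; rewrite ES -map_mx_comp map_mx_id // scalerA.
  by rewrite -(scale0r (mean_step Vo m)); apply: cvgZr_tmp; exact: cvg_odd_div.
Qed.
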